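(* Let $(A,B)$ be a metric $3$-Lie algebra over $F$, let $D\in Der_B(A)$ be invertible, let $\omega(x,y)=B(Dx,y)$ for $x,y\in A$, and let $\delta\in Der_B(A)$ satisfy $\delta([A,A,A])=0$ and $\delta D-D\delta=2\delta$. Let $(\tilde A=b\oplus A\oplus b^*,T)$ be the double extension of $(A,B)$ by means of $\delta$, where $b=Fe_1+Fe_2$ is the $2$-dimensional $3$-Lie algebra (with zero bracket). Let $\tilde\omega$ be the skew-symmetric bilinear form on $\tilde A$ determined by $$\tilde\omega(x,y)=\omega(x,y)\ \ (x,y\in A),\qquad \tilde\omega(e_1,e_1^* )=\tilde\omega(e_2,e_2^* )=-1,$$ all other pairings among $A$ and $e_1,e_2,e_1^*,e_2^*$ being zero (up to skew-symmetry). Then $(\tilde A,T,\tilde\omega)$ is a metric symplectic $3$-Lie algebra.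
   Context: $F$ is an algebraically closed field of characteristic zero. A $3$-Lie algebra over $F$ is an $F$-vector space $L$ with a trilinear, totally skew-symmetric bracket satisfying $[[x_1,x_2,x_3],y_2,y_3]=[[x_1,y_2,y_3],x_2,x_3]+[x_1,[x_2,y_2,y_3],x_3]+[x_1,x_2,[x_3,y_2,y_3]]$ for all elements. A derivation is a linear map $D$ with $D[x,y,z]=[Dx,y,z]+[x,Dy,z]+[x,y,Dz]$. A metric on $L$ is a non-degenerate symmetric bilinear form $B$ with $B([x_1,x_2,x_3],x_4)+B(x_3,[x_1,x_2,x_4])=0$ for all $x_i\in L$; then $(L,B)$ is a metric $3$-Lie algebra and $Der_B(L)$ is the set of derivations $D$ of $L$ with $B(Dx,y)+B(x,Dy)=0$ for all $x,y$. A symplectic structure on $L$ is a non-degenerate skew-symmetric bilinear form $\omega$ with $\omega([x_2,x_3,x_4],x_1)-\omega([x_1,x_3,x_4],x_2)+\omega([x_1,x_2,x_4],x_3)-\omega([x_1,x_2,x_3],x_4)=0$ for all $x_i\in L$. If $L$ carries both a metric $B$ and a symplectic structure $\omega$, $(L,B,\omega)$ is called a metric symplectic $3$-Lie algebra. In the claim, $(A,B,\omega)$ with $\omega(x,y)=B(Dx,y)$ is such an algebra, and $(\tilde A,T,\tilde\omega)$ is called the metric symplectic double extension of $(A,B,\omega)$. Double extension. Let $(A,B)$ be a metric $3$-Lie algebra, $\delta\in Der_B(A)$ with $\delta([A,A,A])=0$, $b=Fe_1+Fe_2$ the two-dimensional $3$-Lie algebra, and $b^*$ its dual with dual basis $e_1^*,e_2^*$,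 $e_i^*(e_j)=\delta_{ij}$ (Kronecker delta). Let $\psi:b\wedge b\to End(A)$ be the linear map with $\psi(e_1,e_2)=\delta$, and define $\phi:A\otimes A\otimes b\to b^*$ by $\phi(x_1,x_2,y)(z)=B(\psi(y,z)x_1,x_2)$ for $x_1,x_2\in A$, $y,z\in b$. The double extension of $A$ by means of $\delta$ is the metric $3$-Lie algebra $(\tilde A,T)$ with $\tilde A=b\oplus A\oplus b^*$, bracket, for $y_i\in b$, $x_i\in A$, $f_i\in b^*$, $$[y_1+x_1+f_1,y_2+x_2+f_2,y_3+x_3+f_3]=[x_1,x_2,x_3]_A+\psi(y_2,y_3)x_1-\psi(y_1,y_3)x_2+\psi(y_1,y_2)x_3$$ $$\qquad+\phi(x_1,x_2,y_3)-\phi(x_1,x_3,y_2)+\phi(x_2,x_3,y_1),$$ and metric $T(y_1+x_1+f_1,y_2+x_2+f_2)=B(x_1,x_2)+f_1(y_2)+f_2(y_1)$. *)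

(* Defs.v *)
From mathcomp Require Import all_boot all_algebra.
Set Implicit Arguments.
Unset Strict Implicit.
Unset Printing Implicit Defensive.
Import GRing.Theory.
Local Open Scope ring_scope.

Section ThreeLie.
Variables (F : fieldType) (L : lmodType F).
Implicit Types (br : L -> L -> L -> L) (B omega : L -> L -> F) (D : L -> L).

Record is_3Lie br : Prop := Is3Lie {
  br_linear1 : forall y z, linear (fun x => br x y z);
  br_linear2 : forall x z, linear (fun y => br x y z);
  br_linear3 : forall x y, linear (fun z => br x y z);
  br_skew12 : forall x y z, br y x z = - br x y z;
  br_skew23 : forall x y z, br x z y = - br x y z;
  br_skew13 : forall x y z, br z y x = - br x y z;
  br_fundamental : forall x1 x2 x3 y2 y3,
    br (br x1 x2 x3) y2 y3 =
    br (br x1 y2 y3) x2 x3 + br x1 (br x2 y2 y3) x3 + br x1 x2 (br x3 y2 y3)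
}.

Record is_derivation br D : Prop := IsDerivation {
  der_linear : linear D;
  der_br : forall x y z,
    D (br x y z) = br (D x) y z + br x (D y) z + br x y (D z)
}.

(* For a symmetric or skew-symmetric form the left and right radicals agree,
   so triviality of one of them is non-degeneracy. *)
Definition form_nondegenerate (B : L -> L -> F) : Prop :=
  forall x, (forall y, B x y = 0) -> x = 0.

Record is_metric br B : Prop := IsMetric {
  metric_bilinear : bilinear_for *%R *%R B;
  metric_sym : forall x y, B y x = B x y;
  metric_nondeg : form_nondegenerate B;
  metric_inv : forall x1 x2 x3 x4,
    B (br x1 x2 x3) x4 + B x3 (br x1 x2 x4) = 0
}.

Record is_metric_3Lie br B : Prop := IsMetric3Lie {
  metric_3Lie_3Lie : is_3Lie br;
  metric_3Lie_metric : is_metric br B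
}.

(* D \in Der_B(L) *)
Record is_metric_derivation br B D : Prop := IsMetricDerivation {
  mder_der : is_derivation br D;
  mder_skew : forall x y, B (D x) y + B x (D y) = 0
}.

Record is_symplectic_structure br omega : Prop := IsSymplectic {
  sympl_bilinear : bilinear_for *%R *%R omega;
  sympl_skew : forall x y, omega y x = - omega x y;
  sympl_nondeg : form_nondegenerate omega;
  sympl_closed : forall x1 x2 x3 x4,
    omega (br x2 x3 x4) x1 - omega (br x1 x3 x4) x2
    + omega (br x1 x2 x4) x3 - omega (br x1 x2 x3) x4 = 0
}.

Record is_metric_symplectic_3Lie br B omega : Prop := IsMetricSymplectic3Lie {
  msympl_metric_3Lie : is_metric_3Lie br B;
  msympl_symplectic : is_symplectic_structure br omega
}.

End ThreeLie.

Section DoubleExtension.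
Variables (F : fieldType) (A : lmodType F).

(* b = F e_1 + F e_2 is realized as row vectors, so that y 0 i is the
   coordinate of y on basis_b i; indices run over 0, 1 instead of 1, 2. *)
Local Notation b := 'rV[F]_2.
Local Notation "b^*" := 'Hom(b, F^o).
Definition basis_b (i : 'I_2) : b := delta_mx 0 i.

Local Notation dext := (b * A * b^*)%type.

Variables (br : A -> A -> A -> A) (B omega : A -> A -> F) (delta : A -> A).

(* The linear map on the exterior square of b sending e_1 /\ e_2 to delta:
   y /\ z is the 2x2 minor of (y, z) times e_1 /\ e_2. *)
Definition psi (y z : b) (x : A) : A :=
  (y 0 0 * z 0 1 - y 0 1 * z 0 0) *: delta x.

(* linfun f is the linear map f only when f is indeed linear, which is the case
   here as soon as B is linear in its first argument. *)
Definition phi (x1 x2 : A) (y : b) : b^* :=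
  linfun (fun z : b => B (psi y z x1) x2 : F^o).

Definition dext_br (u1 u2 u3 : dext) : dext :=
  let: (y1, x1, _) := u1 in
  let: (y2, x2, _) := u2 in
  let: (y3, x3, _) := u3 in
  (0,
   br x1 x2 x3 + psi y2 y3 x1 - psi y1 y3 x2 + psi y1 y2 x3,
   phi x1 x2 y3 - phi x1 x3 y2 + phi x2 x3 y1).

Definition dext_metric (u1 u2 : dext) : F :=
  let: (y1, x1, f1) := u1 in
  let: (y2, x2, f2) := u2 in
  B x1 x2 + f1 y2 + f2 y1.

(* The skew-symmetric bilinear form extending omega whose only other nonzero
   values on generators are -1 on (e_i, e_i^* ) and 1 on (e_i^*, e_i): here
   y 0 i is the coordinate of y on e_i, and f (e_i) that of f on e_i^*. *)
Definition dext_omega (u1 u2 : dext) : F :=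
  let: (y1, x1, f1) := u1 in
  let: (y2, x2, f2) := u2 in
  omega x1 x2 + \sum_(i < 2) (- (y1 0 i * f2 (basis_b i))
                              + f1 (basis_b i) * y2 0 i).

End DoubleExtension.

(* Main.v *)
Require Import Defs.
From HB Require Import structures.
From mathcomp Require Import all_boot all_algebra ring.
Import GRing.Theory.
Local Open Scope ring_scope.

(** On any metric 3-Lie algebra, an injective metric derivation D turns the
    metric into a symplectic form (x, y) |-> B (D x) y: closedness is the
    derivation rule B (D [x1, x2, x3]) x4 = ... read through the total
    skew-symmetry of (x1, x2, x3, x4) |-> B [x1, x2, x3] x4
    ([metric_derivation_symplectic]).  The theorem applies this to the double
    extension.  There the form [dext_omega] comes from the map [dext_der] that
    is -1 on b, D on A and +1 on b^*; it is a derivation because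
    delta D - D delta = 2 delta compensates the weight -2 of e_1 /\ e_2 in
    [e_1, e_2, x] = delta x, and the rise of weight from -1 on b to +1 on b^*
    in [x1, x2, y] ([dext_der_metric_derivation]).

    That the double extension is a metric 3-Lie algebra at all
    ([dext_metric_3Lie]) has to be proved too.  Its metric T is non-degenerate,
    so every identity between brackets can be tested by pairing with a further
    element w, which reduces it to a polynomial identity between scalars: the
    values of B on A, the skew form beta (x, y) = B (delta x) y and the 2x2
    minors of the b-coordinates.  The formula for T [u1, u2, u3] u4
    ([dext_metric_br]) is totally skew-symmetric, which gives the skew-symmetry
    of the bracket and the invariance of T.  For the fundamental identity,
    delta [A, A, A] = 0 and invariance of B make delta A central
    ([delta_central]), so in an iterated bracket only the iterated bracket of A
    and quadratic terms in the minors with coefficients B (delta x) (delta y)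
    survive ([dext_metric_br_br]); the latter cancel by the Pluecker relations
    between minors and the symmetry of B. *)

(** * Metric derivations and symplectic structures *)

Section MetricForm.
Set Implicit Arguments.
Unset Strict Implicit.
Variables (F : fieldType) (L : lmodType F).
Variables (br : L -> L -> L -> L) (B : L -> L -> F).

Lemma form_nondegenerate_ext (bilB : bilinear_for *%R *%R B)
    (ndB : form_nondegenerate B) (u v : L) :
  (forall w, B u w = B v w) -> u = v.
Proof.
pose f : {bilinear L -> L -> F | *%R & *%R} :=
  HB.pack B (bilinear_isBilinear.Build F L L F *%R *%R B bilB).
move=> uv; apply/eqP; rewrite -subr_eq0; apply/eqP/ndB => w.
by rewrite -[B _ _]/(f _ _) linearBl /= uv subrr.
Qed.

Hypothesis hLB : is_metric_3Lie br B.
Let hL := metric_3Lie_3Lie hLB.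
Let hB := metric_3Lie_metric hLB.

HB.instance Definition _ :=
  bilinear_isBilinear.Build F L L F *%R *%R B (metric_bilinear hB).

Lemma metric_br_skew12 x1 x2 x3 x4 :
  B (br x2 x1 x3) x4 = - B (br x1 x2 x3) x4.
Proof. by rewrite (br_skew12 hL) linearNl. Qed.

Lemma metric_br_skew23 x1 x2 x3 x4 :
  B (br x1 x3 x2) x4 = - B (br x1 x2 x3) x4.
Proof. by rewrite (br_skew23 hL) linearNl. Qed.

Lemma metric_br_skew34 x1 x2 x3 x4 :
  B (br x1 x2 x4) x3 = - B (br x1 x2 x3) x4.
Proof.
apply/eqP; rewrite -addr_eq0 addrC (metric_sym hB x3).
by rewrite (metric_inv hB).
Qed.

(** The alternating sum of closedness is, up to the cyclic rotation of the
    4-form B [x1, x2, x3] x4 (odd, hence the signs), the derivation rule for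
    D [x1, x2, x3] paired with x4. *)
Lemma metric_derivation_symplectic (D : L -> L) (omega : L -> L -> F)
    (hD : is_metric_derivation br B D) (injD : injective D)
    (omegaE : forall x y, omega x y = B (D x) y) :
  is_symplectic_structure br omega.
Proof.
pose Dl : {linear L -> L} :=
  HB.pack D (GRing.isLinear.Build F L L _ D (der_linear (mder_der hD))).
have DB x y : B (D x) y = - B x (D y).
  by apply/eqP; rewrite -addr_eq0 (mder_skew hD).
split.
- split=> [z|z] a x y; rewrite !omegaE; last by rewrite linearPr.
  by rewrite -[D _]/(Dl _) linearP linearPl.
- by move=> x y; rewrite !omegaE (metric_sym hB) DB opprK.
- move=> x Dx0; apply: injD; rewrite -[RHS]/(Dl 0) linear0.
  by apply: (metric_nondeg hB) => y; rewrite -omegaE.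
- move=> x1 x2 x3 x4; rewrite !omegaE.
  (* D is moved to the last argument in three of the summands, and distributed
     over the bracket in the fourth. *)
  rewrite (der_br (mder_der hD) x1 x2 x3) 3!DB !linearDl /=.
  have rot y1 y2 y3 y4 : B (br y1 y2 y3) y4 = - B (br y2 y3 y4) y1.
    by rewrite metric_br_skew12 metric_br_skew23 metric_br_skew34 !opprK.
  rewrite (rot (D x1)) (metric_br_skew12 (D x2)) (rot (D x2)).
  by rewrite (metric_br_skew34 _ _ x4 (D x3)); ring.
Qed.
End MetricForm.

(** * The metric of the double extension *)

Section DoubleExtension.
Set Implicit Arguments.
Unset Strict Implicit.
Variables (F : fieldType) (A : lmodType F).
Variables (br : A -> A -> A -> A) (B : A -> A -> F).
Hypothesis hAB : is_metric_3Lie br B.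
Let hA := metric_3Lie_3Lie hAB.
Let hB := metric_3Lie_metric hAB.
Variable delta : A -> A.
Hypothesis hdelta : is_metric_derivation br B delta.
Hypothesis delta_br : forall x y z, delta (br x y z) = 0.

HB.instance Definition _ :=
  bilinear_isBilinear.Build F A A F *%R *%R B (metric_bilinear hB).
HB.instance Definition _ :=
  GRing.isLinear.Build F A A _ delta (der_linear (mder_der hdelta)).

Local Notation b := 'rV[F]_2.
Local Notation dext := (b * A * 'Hom(b, F^o))%type.

Definition minor (y z : b) : F := y 0 0 * z 0 1 - y 0 1 * z 0 0.

Lemma phiE x1 x2 y z :
  phi B delta x1 x2 y z = minor y z * B (delta x1) x2.
Proof.
pose f (z : b) : F^o := B (psi delta y z x1) x2.
have lin_f : linear f.
  move=> a u v; rewrite /f /psi !linearZl_LR !mxE /= /GRing.scale /=; ring.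
pose fl : {linear b -> F^o} :=
  HB.pack f (GRing.isLinear.Build F b F^o _ f lin_f).
by rewrite /phi (lfunE fl) /= /f /psi linearZl_LR.
Qed.

Lemma delta_skew x y : B (delta y) x = - B (delta x) y.
Proof.
by apply/eqP; rewrite (metric_sym hB) -addr_eq0 addrC (mder_skew hdelta).
Qed.

(** Up to sign, B [delta x, y, z] w is B (delta x) [y, z, w], hence
    B x (delta [y, z, w]) = 0. *)
Lemma delta_central x y z : br (delta x) y z = 0.
Proof.
apply: (metric_nondeg hB) => w.
rewrite (metric_br_skew12 hAB) (metric_br_skew23 hAB) (metric_br_skew34 hAB).
by rewrite (metric_sym hB) delta_skew delta_br linear0l !oppr0.
Qed.

Lemma hom_linear (f : 'Hom(b, F^o)) a y z : f (a *: y + z) = a * f y + f z :> F.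
Proof. by rewrite linearP. Qed.

Lemma hom_linearl (f g : 'Hom(b, F^o)) a y :
  (a *: f + g) y = a * f y + g y :> F.
Proof. by rewrite add_lfunE scale_lfunE. Qed.

Lemma dext_metric_bilinear : bilinear_for *%R *%R (dext_metric B).
Proof.
split=> [[[y x] f]|[[y x] f]] a [[y1 x1] f1] [[y2 x2] f2] /=.
  by rewrite linearPl hom_linear hom_linearl /=; ring.
by rewrite linearPr hom_linear hom_linearl /=; ring.
Qed.

Definition dual_basis_b (i : 'I_2) : 'Hom(b, F^o) :=
  linfun (fun z : b => z 0 i : F^o).

Lemma dual_basis_bE i z : dual_basis_b i z = z 0 i.
Proof.
pose f (z : b) : F^o := z 0 i.
have lin_f : linear f by move=> a u v; rewrite /f !mxE.
exact: (lfunE (HB.pack f (GRing.isLinear.Build F b F^o _ f lin_f))).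
Qed.

Lemma dext_metric_nondegenerate : form_nondegenerate (dext_metric B).
Proof.
move=> [[y x] f] uP; congr (_, _, _).
- apply/rowP => i; rewrite mxE.
  have := uP (0, 0, dual_basis_b i).
  by rewrite /= linear0r linear0 !add0r dual_basis_bE.
- apply: (metric_nondeg hB) => w; have := uP (0, w, 0).
  by rewrite /= linear0 lfunE /= !addr0.
- apply/lfunP => z; have := uP (z, 0, 0).
  by rewrite /= linear0r !lfunE /= add0r addr0.
Qed.

(** * The double extension is a metric 3-Lie algebra *)

Local Notation T := (dext_metric B).
Local Notation dbr := (dext_br br B delta).
Local Notation beta x y := (B (delta x) y).

(** The right-hand side is the sum of the 4-form of A and of the exterior
    product of the 2-forms [minor] and beta: it is skew-symmetric in all four
    arguments once B (delta x) y is. *)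
Lemma dext_metric_br (u1 u2 u3 u4 : dext) :
  T (dbr u1 u2 u3) u4 =
    B (br u1.1.2 u2.1.2 u3.1.2) u4.1.2
    + minor u2.1.1 u3.1.1 * beta u1.1.2 u4.1.2
    - minor u1.1.1 u3.1.1 * beta u2.1.2 u4.1.2
    + minor u1.1.1 u2.1.1 * beta u3.1.2 u4.1.2
    + minor u3.1.1 u4.1.1 * beta u1.1.2 u2.1.2
    - minor u2.1.1 u4.1.1 * beta u1.1.2 u3.1.2
    + minor u1.1.1 u4.1.1 * beta u2.1.2 u3.1.2.
Proof.
case: u1 u2 u3 u4 => [[y1 x1] f1] [[y2 x2] f2] [[y3 x3] f3] [[y4 x4] f4] /=.
rewrite linearDl linearBl linearDl /psi !linearZl_LR linear0.
rewrite !add_lfunE opp_lfunE !phiE /= -!/(minor _ _); ring.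
Qed.

HB.instance Definition _ :=
  bilinear_isBilinear.Build F dext dext F *%R *%R (dext_metric B)
    dext_metric_bilinear.

Lemma dext_metricDl u v w : T (u + v) w = T u w + T v w.
Proof. exact: linearDl. Qed.

(** The b^*-component of a bracket is given through [linfun]; separating
    elements by T avoids comparing such maps directly. *)
Let dext_ext u v : (forall w, T u w = T v w) -> u = v.
Proof.
exact: (form_nondegenerate_ext dext_metric_bilinear
  dext_metric_nondegenerate (u := u) (v := v)).
Qed.

Lemma dext_br_skew12 u1 u2 u3 : dbr u2 u1 u3 = - dbr u1 u2 u3.
Proof.
apply: dext_ext => u4; rewrite linearNl /= !dext_metric_br.
rewrite (metric_br_skew12 hAB) (delta_skew u1.1.2 u2.1.2) /minor; ring.
Qed.

Lemma dext_br_skew23 u1 u2 u3 : dbr u1 u3 u2 = - dbr u1 u2 u3.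
Proof.
apply: dext_ext => u4; rewrite linearNl /= !dext_metric_br.
rewrite (metric_br_skew23 hAB) (delta_skew u2.1.2 u3.1.2) /minor; ring.
Qed.

Lemma dext_br_linear1 u2 u3 : linear (fun u1 => dbr u1 u2 u3).
Proof.
move=> a u v; apply: dext_ext => w.
rewrite dext_metric_br linearPl /= !dext_metric_br /=.
rewrite (br_linear1 hA) linearP /= !linearPl /minor !mxE /=; ring.
Qed.

Lemma br_add_delta x y z t : br (x + delta y) z t = br x z t.
Proof.
have := br_linear1 hA z t 1 (delta y) x.
by rewrite delta_central scaler0 add0r scale1r addrC.
Qed.

Lemma beta_br_add_delta x y z t w :
  beta (br x y z + delta t) w = - B (delta t) (delta w).
Proof.
by rewrite linearD /= delta_br add0r delta_skew (metric_sym hB).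
Qed.

(** The inner bracket has no b-component and its A-component is
    [x1, x2, x3] + delta Y with Y linear in x1, x2, x3.  Inside a further
    bracket delta Y disappears, being central, and under beta the summand
    [x1, x2, x3] disappears, being killed by delta. *)
Lemma dext_metric_br_br (u1 u2 u3 v2 v3 w : dext) :
  T (dbr (dbr u1 u2 u3) v2 v3) w =
    B (br (br u1.1.2 u2.1.2 u3.1.2) v2.1.2 v3.1.2) w.1.2
    - minor v2.1.1 v3.1.1 *
      (minor u2.1.1 u3.1.1 * B (delta u1.1.2) (delta w.1.2)
       - minor u1.1.1 u3.1.1 * B (delta u2.1.2) (delta w.1.2)
       + minor u1.1.1 u2.1.1 * B (delta u3.1.2) (delta w.1.2))
    - minor v3.1.1 w.1.1 *
      (minor u2.1.1 u3.1.1 * B (delta u1.1.2) (delta v2.1.2)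
       - minor u1.1.1 u3.1.1 * B (delta u2.1.2) (delta v2.1.2)
       + minor u1.1.1 u2.1.1 * B (delta u3.1.2) (delta v2.1.2))
    + minor v2.1.1 w.1.1 *
      (minor u2.1.1 u3.1.1 * B (delta u1.1.2) (delta v3.1.2)
       - minor u1.1.1 u3.1.1 * B (delta u2.1.2) (delta v3.1.2)
       + minor u1.1.1 u2.1.1 * B (delta u3.1.2) (delta v3.1.2)).
Proof.
rewrite dext_metric_br.
case: u1 u2 u3 => [[y1 x1] f1] [[y2 x2] f2] [[y3 x3] f3] /=.
pose Y := minor y2 y3 *: x1 - minor y1 y3 *: x2 + minor y1 y2 *: x3.
have -> : br x1 x2 x3 + psi delta y2 y3 x1 - psi delta y1 y3 x2
    + psi delta y1 y2 x3 = br x1 x2 x3 + delta Y.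
  by rewrite /Y linearD linearB !linearZ !addrA.
rewrite br_add_delta !beta_br_add_delta.
have deltaYE z : B (delta Y) z = minor y2 y3 * beta x1 z
    - minor y1 y3 * beta x2 z + minor y1 y2 * beta x3 z.
  rewrite linearD linearB !linearZ /= !linearDl !linearZl_LR.
  by rewrite linearNl /= mulrN.
rewrite !deltaYE /minor !mxE /=; ring.
Qed.

(** After pairing with w, the terms from A cancel by the fundamental identity
    of A, and the coefficients of each B (delta x) (delta y) cancel by the
    Pluecker relation
    minor a b * minor c d - minor a c * minor b d + minor a d * minor b c = 0
    or trivially, which [ring] sees on coordinates. *)
Lemma dext_br_fundamental u1 u2 u3 v2 v3 :
  dbr (dbr u1 u2 u3) v2 v3 =
  dbr (dbr u1 v2 v3) u2 u3 + dbr u1 (dbr u2 v2 v3) u3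
  + dbr u1 u2 (dbr u3 v2 v3).
Proof.
(* Inner brackets are moved to the first slot, the shape of
   dext_metric_br_br. *)
rewrite (dext_br_skew12 (dbr u2 v2 v3)) (dext_br_skew23 u1 (dbr u3 v2 v3)).
rewrite (dext_br_skew12 (dbr u3 v2 v3)) opprK.
apply: dext_ext => w; rewrite linearDl linearBl /= !dext_metric_br_br.
rewrite (br_fundamental hA) !linearDl /=.
rewrite (br_skew12 hA (br u2.1.2 v2.1.2 v3.1.2)).
rewrite (br_skew23 hA u1.1.2 (br u3.1.2 v2.1.2 v3.1.2)).
rewrite (br_skew12 hA (br u3.1.2 v2.1.2 v3.1.2)) opprK linearNl /=.
have deltaC x y : B (delta y) (delta x) = B (delta x) (delta y).
  exact: metric_sym hB _ _.
(* The arguments are brought into the order u1, u2, u3, v2, v3. *)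
rewrite !(deltaC u1.1.2 u2.1.2, deltaC u1.1.2 u3.1.2, deltaC u2.1.2 u3.1.2).
rewrite !(deltaC u1.1.2 v2.1.2, deltaC u2.1.2 v2.1.2, deltaC u3.1.2 v2.1.2).
rewrite !(deltaC u1.1.2 v3.1.2, deltaC u2.1.2 v3.1.2, deltaC u3.1.2 v3.1.2).
rewrite /minor; ring.
Qed.

Lemma dext_metric_3Lie : is_metric_3Lie dbr T.
Proof.
split; split.
- exact: dext_br_linear1.
- move=> u v a x y; rewrite 3!(dext_br_skew12 _ u) dext_br_linear1.
  by rewrite opprD scalerN.
- move=> u v a x y; rewrite 3!(dext_br_skew23 u _ v) 3!(dext_br_skew12 _ u).
  by rewrite dext_br_linear1 !opprK.
- exact: dext_br_skew12.
- exact: dext_br_skew23.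
- move=> u v w.
  by rewrite dext_br_skew12 dext_br_skew23 dext_br_skew12 !opprK.
- exact: dext_br_fundamental.
- exact: dext_metric_bilinear.
- by case=> [[y x] f] [[z t] g] /=; rewrite (metric_sym hB); ring.
- exact: dext_metric_nondegenerate.
- have TC u v : T v u = T u v.
    by case: u v => [[y x] f] [[z t] g] /=; rewrite (metric_sym hB); ring.
  move=> u1 u2 u3 u4; rewrite (TC _ u3) !dext_metric_br.
  rewrite (metric_br_skew34 hAB) (delta_skew u3.1.2 u4.1.2) /minor; ring.
Qed.

(** * The symplectic structure of the double extension *)

Section Derivation.
Variable D : A -> A.
Hypothesis hD : is_metric_derivation br B D.
Hypothesis delta_D : forall x, delta (D x) - D (delta x) = 2 *: delta x.

(** The sign on b is forced by T (dext_der e_i) e_i^* = -1, the value prescribed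
    for the symplectic form. *)
Definition dext_der (u : dext) : dext := (- u.1.1, D u.1.2, u.2).

Lemma dext_omegaE (omega : A -> A -> F) u v :
  (forall x y, omega x y = B (D x) y) ->
  dext_omega omega u v = T (dext_der u) v.
Proof.
case: u v => [[y x] f] [[z t] g] omegaE /=.
rewrite omegaE big_split /= sumrN linearN /= -addrA; congr (_ + _).
rewrite addrC; congr (_ - _).
  rewrite {2}(row_sum_delta z) linear_sum; apply: eq_bigr => i _.
  by rewrite linearZ /= mulrC.
rewrite {2}(row_sum_delta y) linear_sum; apply: eq_bigr => i _.
by rewrite linearZ.
Qed.

Lemma dext_der_injective : injective D -> injective dext_der.
Proof. by move=> injD [[y x] f] [[z t] g] [/oppr_inj-> /injD-> ->]. Qed.

(** Paired with a fourth element, the derivation rule says that the 4-form of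
    [dext_metric_br] is annihilated by dext_der.  Its part in A is annihilated
    by D.  On minor * beta, the b-arguments contribute the weight -2, and D
    contributes beta (D x) y + beta x (D y) = 2 * beta x y. *)
Lemma dext_der_metric_derivation : is_metric_derivation dbr T dext_der.
Proof.
have linD := der_linear (mder_der hD).
have DB x y : B (D x) y = - B x (D y).
  by apply/eqP; rewrite -addr_eq0 (mder_skew hD).
have skew u v : T (dext_der u) v = - T u (dext_der v).
  case: u v => [[y x] f] [[z t] g] /=; rewrite DB !linearN /=; ring.
have deltaD x : delta (D x) = D (delta x) + 2 *: delta x.
  by rewrite -delta_D addrC subrK.
split; last by move=> u v; rewrite skew addNr.
split.
  move=> a [[y x] f] [[z t] g]; rewrite /dext_der /= linD.
  by congr (_, _, _); rewrite opprD -scalerN.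
move=> u1 u2 u3; apply: dext_ext => u4.
rewrite skew 2!dext_metricDl !dext_metric_br /=.
have der4 x1 x2 x3 x4 : B (br x1 x2 x3) (D x4) =
    - (B (br (D x1) x2 x3) x4 + B (br x1 (D x2) x3) x4 + B (br x1 x2 (D x3)) x4).
  by rewrite -!linearDl /= -(der_br (mder_der hD)) DB opprK.
have delta2 x y : beta x (D y) = - beta (D x) y + 2 * beta x y.
  by rewrite deltaD linearDl linearZl_LR /= DB; ring.
by rewrite der4 !delta2 /minor !mxE; ring.
Qed.
End Derivation.
End DoubleExtension.

Theorem mainTheorem5 (F : closedFieldType) (charF0 : [pchar F] =i pred0)
  (A : lmodType F) (br : A -> A -> A -> A) (B : A -> A -> F)
  (hAB : is_metric_3Lie br B)
  (D : A -> A) (hD : is_metric_derivation br B D) (D_inv : bijective D)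
  (omega : A -> A -> F) (omegaE : forall x y, omega x y = B (D x) y)
  (delta : A -> A) (hdelta : is_metric_derivation br B delta)
  (delta_br : forall x y z, delta (br x y z) = 0)
  (delta_D : forall x, delta (D x) - D (delta x) = 2 *: delta x) :
  is_metric_symplectic_3Lie (dext_br br B delta) (dext_metric B)
    (dext_omega omega).
Proof.
have hT := dext_metric_3Lie hAB hdelta delta_br.
split; first exact: hT.
have hDt := dext_der_metric_derivation hAB hD delta_D.
apply: (metric_derivation_symplectic hT hDt).
  exact/dext_der_injective/bij_inj.
by move=> u v; apply: dext_omegaE.
Qed.
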